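(* For every $d\ge2$ and every $\epsilon\le\frac1{10}$, any bounded-error non-adaptive $\epsilon$-tester for convexity of functions $f\colon[n]^d\to\mathbb{R}$ has query complexity $\Omega\!\left((\tfrac nd)^{d/2}\right)$.
   Context: $[n]=\{0,\dots,n-1\}$ and $[n]^d\subseteq\mathbb{R}^d$. A function $f\colon X\to\mathbb{R}$ on a finite set $X\subseteq\mathbb{R}^d$ is convex if for every finite collection $x_1,\dots,x_k\in X$ and reals $\lambda_i\ge0$ with $\sum_i\lambda_i=1$ and $\sum_i\lambda_ix_i\in X$, one has $f(\sum_i\lambda_ix_i)\le\sum_i\lambda_if(x_i)$. $g$ is $\epsilon$-far from convex if every convex $h$ differs from $g$ on at least $\epsilon|X|$ points. A bounded-error $\epsilon$-tester is a randomized query algorithm accepting convex functions with probability at least $2/3$ and rejecting $\epsilon$-far functions with probability at least $2/3$; it is non-adaptive if all queried points are chosen before any value is observed. *)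

(* Defs.v *)
From HB Require Import structures.
From mathcomp Require Import all_boot all_order all_algebra.
From mathcomp Require Import all_classical all_reals all_analysis.
Set Implicit Arguments. Unset Strict Implicit. Unset Printing Implicit Defensive.
Import Order.TTheory GRing.Theory Num.Theory.
Local Open Scope classical_set_scope.
Local Open Scope ring_scope.

(* The grid [n]^d, with [n] = {0,...,n-1}: a point is a map 'I_d -> 'I_n,
   viewed in R^d through its coordinates (x j : nat)%:R. *)
Definition grid (n d : nat) : finType := {ffun 'I_d -> 'I_n}.

Section Convexity.
Variables (R : realType) (n d : nat).

Definition grid_convex (f : grid n d -> R) : Prop :=
  forall (k : nat) (x : 'I_k -> grid n d) (lam : 'I_k -> R) (y : grid n d),
    (forall i, 0 <= lam i) ->
    \sum_(i < k) lam i = 1 ->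
    (forall j : 'I_d, \sum_(i < k) lam i * ((x i j : nat)%:R) = ((y j : nat)%:R)) ->
    f y <= \sum_(i < k) lam i * f (x i).

Definition eps_far (eps : R) (g : grid n d -> R) : Prop :=
  forall h : grid n d -> R, grid_convex h ->
    eps * (#|[set: grid n d]|%:R) <= (#|[set x | g x != h x]|%:R).

(* A randomized non-adaptive algorithm making q queries: on the probability
   space (Omega, P), the random seed w determines the query points Q w
   (chosen before any value is observed) and the decision D w, which only
   sees the q queried values.  It is a bounded-error eps-tester for convexity
   if the acceptance events are measurable, convex functions are accepted
   with probability >= 2/3, and eps-far functions rejected with prob. >= 2/3. *)
Definition nonadaptive_convexity_tester (eps : R) (q : nat)
    (dm : measure_display) (Omega : measurableType dm) (P : probability Omega R)
    (Q : Omega -> 'I_q -> grid n d) (D : Omega -> ('I_q -> R) -> bool) : Prop :=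
  (forall f : grid n d -> R,
      measurable [set w | D w (fun i => f (Q w i))]) /\
  (forall f : grid n d -> R, grid_convex f ->
      ((2 / 3 : R)%:E <= P [set w | D w (fun i => f (Q w i))])%E) /\
  (forall f : grid n d -> R, eps_far eps f ->
      ((2 / 3 : R)%:E <= P [set w | ~~ D w (fun i => f (Q w i))])%E).

End Convexity.

(* Main.v *)
(* An integer vector v with 3 |v|_1 <= n and coprime entries v_0, v_1 cuts the grid
   into blocks, the windows of three consecutive points on the lines of direction v.
   A convex base function that is affine on every block, and strictly convex across
   blocks, remains convex when a small constant is added on each block.  The convex
   instances add a uniformly random constant u(B) / 60, u(B) in Z/60, on each block B;
   the far instances moreover shift u(B) by 1 modulo 60 at the central point of B,
   which breaks convexity inside B unless the shift wraps around.  At least a ninth of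
   the points are centers of complete blocks, so the far instances are 1/10-far for at
   least 5/6 of the seeds.  A single query per block sees the same distribution in both
   cases, so a tester has to hit some block twice.  Two points of a block differ by
   +-v or +-2v: a set of q queries can succeed for at most 4 q^2 directions v, whereas
   there are at least c (n/d)^d of them. *)

Require Import Defs.
From HB Require Import structures.
From mathcomp Require Import all_boot all_order all_algebra.
From mathcomp Require Import all_classical all_reals all_analysis.
From mathcomp Require Import measurable_realfun unstable.
From mathcomp Require Import zify ring lra.
Set Implicit Arguments. Unset Strict Implicit. Unset Printing Implicit Defensive.
Import Order.TTheory GRing.Theory Num.Theory.
Local Open Scope ring_scope.

(** * Convexity on the grid *)

Section IntegralAffine.
Variables (R : realType) (n d : nat).
Implicit Types (S T : grid n d -> int).

Definition grid_affine T : Prop := forall (k : nat) (x : 'I_k -> grid n d)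
    (lam : 'I_k -> R) (y : grid n d),
  \sum_(i < k) lam i = 1 ->
  (forall j, \sum_(i < k) lam i * (x i j : nat)%:R = (y j : nat)%:R) ->
  \sum_(i < k) lam i * (T (x i))%:~R = (T y)%:~R.

Lemma grid_affine_cst (c : int) : grid_affine (fun=> c).
Proof. by move=> k x lam y lam1 _; rewrite -mulr_suml lam1 mul1r. Qed.

Lemma grid_affine_coord (j : 'I_d) : grid_affine (fun x => (x j : nat)%:Z).
Proof. by move=> k x lam y _; apply. Qed.

Lemma grid_affineD S T :
  grid_affine S -> grid_affine T -> grid_affine (fun x => S x + T x).
Proof.
move=> affS affT k x lam y lam1 baryc.
rewrite intrD -(affS _ _ _ _ lam1 baryc) -(affT _ _ _ _ lam1 baryc) -big_split.
by apply: eq_bigr => i _; rewrite intrD mulrDr.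
Qed.

Lemma grid_affineM (c : int) T : grid_affine T -> grid_affine (fun x => c * T x).
Proof.
move=> affT k x lam y lam1 baryc.
rewrite intrM -(affT _ _ _ _ lam1 baryc) mulr_sumr.
by apply: eq_bigr => i _; rewrite intrM mulrCA.
Qed.

Lemma grid_affineN T : grid_affine T -> grid_affine (fun x => - T x).
Proof.
move=> /(grid_affineM (-1)) affN k x lam y lam1 baryc.
rewrite -mulN1r -(affN _ _ _ _ lam1 baryc).
by apply: eq_bigr => i _; rewrite mulN1r.
Qed.

Lemma grid_affine_sum (I : finType) (F : I -> grid n d -> int) :
  (forall i, grid_affine (F i)) -> grid_affine (fun x => \sum_i F i x).
Proof.
move=> affF k x lam y lam1 baryc; rewrite [RHS]rmorph_sum /=.
rewrite -(eq_bigr _ (fun i _ => affF i _ _ _ _ lam1 baryc)) exchange_big.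
by apply: eq_bigr => i _; rewrite rmorph_sum mulr_sumr.
Qed.

End IntegralAffine.

Section GridConvexity.
Variables (R : realType) (n d : nat).

Lemma convex_block_perturbation (J : eqType) (B : grid n d -> J)
    (f : grid n d -> int) (g : J -> R) :
  (forall y, exists2 T, grid_affine R T &
    forall x, T x <= f x ?= iff (B x == B y)) ->
  (forall b, 0 <= g b <= 1) -> grid_convex (fun x => (f x)%:~R + g (B x)).
Proof.
move=> support g01 k x lam y lam_ge0 lam1 baryc.
have [T affT leT] := support y.
have <- : T y = f y by apply/eqP; rewrite (leT y).2.
have <- : (\sum_i lam i) * g (B y) = g (B y) by rewrite lam1 mul1r.
rewrite -(affT _ _ _ _ lam1 baryc) mulr_suml -big_split /=.
apply: ler_sum => i _; rewrite -mulrDr; apply: ler_wpM2l => //.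
have [eqB | neB] := eqVneq (B (x i)) (B y).
  by rewrite eqB lerD2r ler_int (leT _).1.
have : T (x i) + 1 <= f (x i).
  by rewrite lezD1 lt_neqAle (leT (x i)).2 (negPf neB) (leT _).1.
rewrite -(ler_int R) intrD.
by have /andP[_] := g01 (B y); have /andP[+ _] := g01 (B (x i)); lra.
Qed.

Lemma convex_midpoint (h : grid n d -> R) (a b y : grid n d) :
  grid_convex h -> (forall j, a j + b j = (y j).*2)%N -> 2 * h y <= h a + h b.
Proof.
move=> convh mid.
have := convh 2%N (fun i => if i == ord0 then a else b) (fun=> 2^-1) y.
rewrite !big_ord_recl !big_ord0 /= !addr0 => le_mid.
suff: h y <= 2^-1 * h a + 2^-1 * h b by clear le_mid; lra.
apply: le_mid => [i||j]; [by rewrite invr_ge0 | by lra |].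
rewrite !big_ord_recl !big_ord0 /= addr0.
by have := congr1 (fun k => k%:R : R) (mid j); rewrite -muln2 natrD natrM; lra.
Qed.

End GridConvexity.

(** * The block decomposition along a direction *)

Lemma leif_tangent_sqr (K : realDomainType) (a b : K) :
  2 * a * b - a ^+ 2 <= b ^+ 2 ?= iff (b == a).
Proof.
rewrite -(mono_leif (lerD2r (a ^+ 2))) subrK -mulrA mulrC [a * b]mulrC mulr_natr.
exact: leif_mean_square_scaled.
Qed.

(* The function [t |-> window_line W (t %/ W) t] is the maximum over [b] of the
   lines [window_line W b]; its breakpoints lie at the half-integers [b * W - 1/2],
   so that among the integers no maximizing line is tied. *)
Definition window_line (W b t : nat) : int :=
  b%:Z * (2 * t%:Z + 1) - W%:Z * (b%:Z * (b%:Z + 1)).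

Lemma window_line_leif (W b t : nat) : (0 < W)%N ->
  window_line W b t <= window_line W (t %/ W) t ?= iff (t %/ W == b)%N.
Proof.
move=> W_gt0; set w := (t %/ W)%N; apply/leifP.
have le_t : (w * W <= t)%N by exact: leq_trunc_div.
have t_lt : (t < w.+1 * W)%N by rewrite ltn_ceil.
have -> : window_line W w t = window_line W b t
    + (w%:Z - b%:Z) * (2 * t%:Z + 1 - W%:Z * (w%:Z + b%:Z + 1)).
  by rewrite /window_line; ring.
case: (ltngtP w b) => [lt_wb | lt_bw | ->]; last by rewrite subrr mul0r addr0.
  by rewrite ltrDl nmulr_rgt0; [nia | lia].
by rewrite ltrDl pmulr_rgt0; [nia | lia].
Qed.

Section Blocks.
Variables (n d : nat) (i0 : 'I_d) (v : 'I_d -> int).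
Implicit Types (x y : grid n d) (s t : int).

Definition cross x (i : 'I_d) : int :=
  v i0 * (x i : nat)%:Z - v i * (x i0 : nat)%:Z.

Definition rank x : nat := (x i0 %/ `|v i0|)%N.

Definition window x : nat := (rank x %/ 3)%N.

Definition block x : {set grid n d} :=
  [set y | [forall i, cross y i == cross x i] && (window y == window x)]%SET.

Definition central x : bool := (rank x %% 3 == 1)%N.

Definition interior x : bool := [forall i, (`|v i| <= x i) && (x i + `|v i| < n)]%N.

Definition centers : {set grid n d} := [set x | central x && interior x]%SET.

Definition base x : int :=
  \sum_i cross x i ^+ 2 + window_line (`|v i0| * 3) (window x) (x i0).

Definition tangent y x : int :=
  \sum_i (2 * cross y i * cross x i - cross y i ^+ 2)
  + window_line (`|v i0| * 3) (window y) (x i0).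

Lemma eq_block x y :
  (block x == block y) = [forall i, cross x i == cross y i] && (window x == window y).
Proof.
apply/eqP/andP => [eqB | [/forallP eqc /eqP eqw]].
  have: x \in block x by rewrite inE eqxx andbT; apply/forallP.
  by rewrite eqB inE => /andP.
apply/setP => z; rewrite !inE eqw; congr (_ && _).
by apply: eq_forallb => i; rewrite (eqP (eqc i)).
Qed.

Lemma tangent_affine (R : realType) y : grid_affine R (tangent y).
Proof.
have coord := @grid_affine_coord R n d; have cst := @grid_affine_cst R n d.
apply: grid_affineD; first apply: grid_affine_sum => i.
  apply: grid_affineD (cst _); apply: grid_affineM.
  by apply: grid_affineD; [|apply: grid_affineN]; apply: grid_affineM.
by apply: grid_affineD (cst _); apply/grid_affineM/grid_affineD/cst/grid_affineM.
Qed.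

Definition translate s y : grid n d :=
  [ffun i => insubd (y i) (absz ((y i : nat)%:Z + s * v i))].

Lemma translateE s y i : y \in centers -> `|s| = 1 ->
  (translate s y i : nat)%:Z = (y i : nat)%:Z + s * v i.
Proof.
rewrite inE => /andP[_ /forallP/(_ i) int_y] s1.
have s_cases : s = 1 \/ s = -1 by lia.
by rewrite ffunE val_insubd; case: s_cases => ->; case: ifP; lia.
Qed.

Lemma translate_midpoint y : y \in centers ->
  forall j, (translate 1%R y j + translate (-1)%R y j = (y j).*2)%N.
Proof.
move=> yC j; have := translateE (s := 1) j yC (normr1 _).
by have := translateE (s := -1) j yC (normrN1 _); lia.
Qed.

Hypothesis v0_neq0 : v i0 != 0.

Lemma tangent_leif y x : tangent y x <= base x ?= iff (block x == block y).
Proof.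
rewrite eq_block; apply: leifD.
  by apply: leif_sum => i _; exact: leif_tangent_sqr.
rewrite /window /rank -!divnMA; apply: window_line_leif.
by rewrite muln_gt0 absz_gt0 v0_neq0.
Qed.

Lemma rank_translate t x y : (y i0 : nat)%:Z = (x i0 : nat)%:Z + t * v i0 ->
  (rank y)%:Z = (rank x)%:Z + t * sgz (v i0).
Proof.
move=> yE; rewrite -!divz_nat yE.
have -> : (x i0 : nat)%:Z + t * v i0
          = t * sgz (v i0) * `|v i0|%N%:Z + (x i0 : nat)%:Z.
  by rewrite -mulrA -intEsg addrC.
by rewrite divzMDl 1?addrC // eqz_nat absz_eq0.
Qed.

Section Neighbours.
Variables (s : int) (y : grid n d).
Hypotheses (yC : y \in centers) (s1 : `|s| = 1).

Let central_y : central y.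
Proof. by move: yC; rewrite inE => /andP[]. Qed.

Let rank_neighbour : (rank (translate s y))%:Z = (rank y)%:Z + s * sgz (v i0).
Proof. exact/rank_translate/translateE. Qed.

Let sign_step : s * sgz (v i0) = 1 \/ s * sgz (v i0) = -1.
Proof. by case: sgzP v0_neq0 => // _ _; lia. Qed.

Lemma block_translate : block (translate s y) = block y.
Proof.
apply/eqP; rewrite eq_block; apply/andP; split.
  by apply/forallP => i; rewrite /cross !translateE //; apply/eqP; ring.
by move: central_y; rewrite /window /central; case: sign_step; lia.
Qed.

Lemma central_translate : central (translate s y) = false.
Proof. by move: central_y; rewrite /central; case: sign_step; lia. Qed.

Lemma base_translate :
  base (translate s y) = base y + 2 * s * (window y)%:Z * v i0.
Proof.
have /eqP := block_translate; rewrite eq_block => /andP[/forallP eqc /eqP eqw].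
rewrite /base /window_line eqw translateE // (eq_bigr (fun i => cross y i ^+ 2)).
  by ring.
by move=> i _; rewrite (eqP (eqc i)).
Qed.

End Neighbours.

Lemma convex_base_perturbation (R : realType) (g : {set grid n d} -> R) :
  (forall B, 0 <= g B <= 1) -> grid_convex (fun x => (base x)%:~R + g (block x)).
Proof.
move=> g01; apply: convex_block_perturbation => // y; exists (tangent y).
  exact: tangent_affine.
exact: tangent_leif.
Qed.

Variable i1 : 'I_d.
Hypothesis v_coprime : coprimez (v i0) (v i1).

Lemma eq_block_multiple x y : block x = block y ->
  exists2 t, (`|t| <= 2)%N & forall i, (y i : nat)%:Z = (x i : nat)%:Z + t * v i.
Proof.
move=> /eqP; rewrite eq_block => /andP[/forallP eqc /eqP eqw].
have slope i : v i0 * ((y i : nat)%:Z - (x i : nat)%:Z)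
               = v i * ((y i0 : nat)%:Z - (x i0 : nat)%:Z).
  by have /eqP := eqc i; rewrite /cross; lia.
have /dvdzP[t tE] : (v i0 %| (y i0 : nat)%:Z - (x i0 : nat)%:Z)%Z.
  by rewrite -(Gauss_dvdzr _ v_coprime) -slope dvdz_mulr.
have yE i : (y i : nat)%:Z = (x i : nat)%:Z + t * v i.
  have /(mulfI v0_neq0) : v i0 * ((y i : nat)%:Z - (x i : nat)%:Z) = v i0 * (t * v i).
    by rewrite slope tE; ring.
  by lia.
exists t => //; move: eqw (rank_translate (yE i0)) v0_neq0; rewrite /window.
by case: sgzP => // _; lia.
Qed.

Lemma centers_block_inj : {in centers &, injective block}.
Proof.
move=> x y; rewrite !inE => /andP[cx _] /andP[cy _] eqB.
have [t _ yE] := eq_block_multiple eqB.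
have /eqP := eqB; rewrite eq_block => /andP[_ /eqP eqw].
have t0 : t = 0.
  move: eqw cx cy (rank_translate (yE i0)) v0_neq0; rewrite /window /central.
  by case: sgzP => // _; lia.
by apply/ffunP => i; apply/val_inj; have := yE i; rewrite t0 mul0r addr0 => -[].
Qed.

End Blocks.

(** * Counting the centers *)

Lemma leq_prod_subn (I : finType) (n : nat) (b : I -> nat) :
  (n * n ^ #|I| <= n * \prod_i (n - b i) + (\sum_i b i) * n ^ #|I|)%N.
Proof.
rewrite -prod_nat_const.
suff: (\prod_(i : I) (n - b i) <= \prod_(i : I) n /\
  n * \prod_(i : I) n <= n * \prod_i (n - b i) + (\sum_i b i) * \prod_(i : I) n)%N.
  by case.
elim/big_rec3: _ => [|i S N P _ [le_PN IH]]; first by rewrite addn0.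
split; first by rewrite leq_mul ?leq_subr.
have split_n : (n * (n * P) <= n * ((n - b i) * P) + b i * (n * P))%N.
  by rewrite mulnCA -mulnDl leq_mul2r; lia.
have : (n * (n * N) <= n * (n * P) + n * (S * N))%N.
  by rewrite -mulnDr leq_mul2l IH orbT.
have : (b i * (n * P) <= b i * (n * N))%N by rewrite !leq_mul2l le_PN !orbT.
by lia.
Qed.

Lemma card_interior_coord (a n : nat) :
  (n - 2 * a <= #|[pred t : 'I_n | (a <= t) && (t + a < n)]|)%N.
Proof.
have lt_n (t : 'I_(n - 2 * a)) : (t + a < n)%N by have := ltn_ord t; lia.
pose shift t := Ordinal (lt_n t).
have inj : injective shift by move=> t t' [/addIn/ord_inj].
rewrite -{1}[(n - 2 * a)%N]card_ord -(card_imset _ inj).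
apply/subset_leq_card/fintype.subsetP => _ /imsetP[t _ ->]; rewrite inE /=.
by have := ltn_ord t; lia.
Qed.

Lemma card_central_coord (a n : nat) : (0 < a)%N ->
  (n - 2 * a <= 3 * #|[pred t : 'I_n |
    [&& (t %/ a) %% 3 == 1, a <= t & t + a < n]]|)%N.
Proof.
move=> a_gt0; pose r t := ((t %/ a) %% 3)%N.
have le_r t : (r t * a <= t)%N by rewrite -leq_divRL // leq_mod.
have lt_n (t : 'I_(n - 2 * a)) : (t - r t * a + a < n)%N.
  by have := ltn_ord t; have := le_r t; lia.
pose shift (t : 'I_(n - 2 * a)) := (inord (r t) : 'I_3, Ordinal (lt_n t)).
have inj : injective shift.
  move=> t t' [/(congr1 val) /=]; rewrite !inordK ?ltn_pmod // => eq_r.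
  rewrite eq_r => /addIn eq_low; apply: ord_inj.
  by rewrite -(subnK (le_r t)) -(subnK (le_r t')) eq_r eq_low.
set C := [pred t : 'I_n | _].
have <- : #|[predX predT : pred 'I_3 & C]| = (3 * #|C|)%N by rewrite cardX card_ord.
rewrite -{1}[(n - 2 * a)%N]card_ord -(card_imset _ inj).
apply/subset_leq_card/fintype.subsetP => _ /imsetP[t _ ->]; rewrite !inE /=.
rewrite divnDr ?dvdnn // divnBMl divnn a_gt0 /=.
have := ltn_ord t; have := le_r t; rewrite /r.
by set k := (t %/ a)%N; lia.
Qed.

Lemma card_centers (n d : nat) (i0 : 'I_d) (v : 'I_d -> int) :
  v i0 != 0 -> (0 < n)%N -> (3 * \sum_i `|v i| <= n)%N ->
  (n ^ d <= 9 * #|centers n i0 v|)%N.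
Proof.
move=> v0_neq0 n_gt0 v_small.
pose slice (i : 'I_d) := if i == i0
  then [pred t : 'I_n | [&& (t %/ `|v i|) %% 3 == 1, `|v i| <= t & t + `|v i| < n]%N]
  else [pred t : 'I_n | (`|v i| <= t) && (t + `|v i| < n)]%N.
have -> : #|centers n i0 v| = (\prod_(i < d) #|slice i|)%N.
  transitivity #|family slice|; last by rewrite card_family foldrE big_image.
  apply: eq_card => x; rewrite inE.
  apply/andP/familyP => [[cx /forallP int_x] i | slx].
    by rewrite /slice; case: eqVneq => [-> | _]; rewrite inE ?int_x ?andbT.
  have int_x i : (`|v i| <= x i) && (x i + `|v i| < n)%N.
    by have := slx i; rewrite /slice; case: eqP => _; rewrite inE // => /andP[].
  split; last exact/forallP.
  by have := slx i0; rewrite /slice eqxx inE => /andP[].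
have le_slices : (\prod_(i < d) (n - 2 * `|v i|) <= 3 * \prod_(i < d) #|slice i|)%N.
  rewrite (bigD1 i0) //= [in leqRHS](bigD1 i0) //= mulnA leq_mul //.
    by rewrite /slice eqxx card_central_coord // absz_gt0.
  by apply: leq_prod => i /negPf ne; rewrite /slice ne card_interior_coord.
rewrite -(leq_pmul2l n_gt0); have := leq_prod_subn n (fun i : 'I_d => 2 * `|v i|)%N.
rewrite card_ord -big_distrr /=.
move: le_slices; set P := (\prod_(i < d) #|_|)%N; set M := (\prod_(i < d) _)%N.
move: v_small; set S := (\sum_i _)%N; set N := (n ^ d)%N; move: S P M N.
by clear; nia.
Qed.

(** * The convex and the far instances *)

Lemma leq_markov (I : finType) (F : I -> nat) (m : nat) :
  (m * #|[set i | (m <= F i)%N]%SET| <= \sum_i F i)%N.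
Proof.
rewrite mulnC -sum_nat_const big_mkcond; apply: leq_sum => i _.
by case: ifP; rewrite ?inE.
Qed.

Lemma card_ffun_coord (aT rT : finType) (a : aT) (S : {pred rT}) :
  (#|[set f : {ffun aT -> rT} | f a \in S]%SET| * #|rT|
   = #|S| * #|{ffun aT -> rT}|)%N.
Proof.
pose F (b : aT) : pred rT := fun t => (b == a) ==> (t \in S).
have -> : #|[set f : {ffun aT -> rT} | f a \in S]%SET| = #|family F|.
  apply: eq_card => f; rewrite inE; apply/idP/familyP => [fa b | /(_ a)].
    by rewrite unfold_in; apply/implyP => /eqP ->.
  by rewrite unfold_in eqxx.
rewrite card_family foldrE big_image /= (bigD1 a) //=.
have -> : #|F a| = #|S| by apply: eq_card => t; rewrite unfold_in eqxx.
rewrite (eq_bigr (fun=> #|rT|)) => [|b /negPf ne]; last first.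
  by apply: eq_card => t; rewrite unfold_in ne.
rewrite prod_nat_const card_ffun -mulnA -expnSr; congr (_ * #|rT| ^ _)%N.
by rewrite (cardC1 a) prednK //; apply/card_gt0P; exists a.
Qed.

Lemma val_Zp_succ (p : nat) (c : 'I_p.+2) :
  c != -1 -> (c + 1 : 'I_p.+2) = c.+1 :> nat.
Proof.
move=> cN1; rewrite /= [(1 %% _)%N]modn_small // addn1 modn_small //.
rewrite ltn_neqAle ltn_ord andbT; apply: contraNneq cN1 => -[cE].
by apply/eqP/val_inj; rewrite /= cE [(1 %% _)%N]modn_small // subn1 modn_small.
Qed.

(* A shift modulo 60 wraps around for 1/60 of the centers on average, hence for more
   than 1/10 of them for at most 1/6 of the seeds. *)
Local Notation seed n d := {ffun {set grid n d} -> 'Z_60}.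

Section Instances.
Variables (R : realType) (n d : nat) (i0 : 'I_d) (v : 'I_d -> int).
Implicit Types (x y : grid n d).

Local Notation block := (block i0 v).
Local Notation centers := (centers n i0 v).
Implicit Types u : seed n d.

Definition perturbed_base (c : grid n d -> 'Z_60) x : R :=
  (base i0 v x)%:~R + (c x : nat)%:R / 60.

Definition convex_instance u : grid n d -> R :=
  perturbed_base (fun x => u (block x)).

Definition far_instance u : grid n d -> R :=
  perturbed_base (fun x => u (block x) + (central i0 v x)%:R).

Definition wrapped_centers u : {set grid n d} :=
  [set y | (y \in centers) && (u (block y) == -1)]%SET.

Definition bad_seeds : {set seed n d} :=
  [set u | (#|centers| < 10 * #|wrapped_centers u|)%N]%SET.

Lemma sum_wrapped_centers :
  (60 * (\sum_u #|wrapped_centers u|) = #|centers| * #|{: seed n d}|)%N.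
Proof.
under eq_bigr do rewrite -sum1_card.
under eq_bigr do (under eq_bigl do rewrite inE).
rewrite (exchange_big_dep (mem centers)) /=; last by move=> u y _ /andP[].
rewrite -sum_nat_const big_distrr /=; apply: eq_bigr => y yC.
have := card_ffun_coord (block y) (pred1 (-1 : 'Z_60)).
rewrite card1 mul1n card_ord => <-; rewrite mulnC; congr (_ * _)%N.
by rewrite -sum1_card; apply: eq_bigl => u; rewrite yC !inE.
Qed.

Lemma card_bad_seeds : (6 * #|bad_seeds| <= #|{: seed n d}|)%N.
Proof.
have := leq_markov (fun u => 10 * #|wrapped_centers u|)%N #|centers|.+1.
rewrite -big_distrr -/bad_seeds /=; have := sum_wrapped_centers.
set S := (\sum_u _)%N; set C := #|centers|; set B := #|bad_seeds|.
by move: #|{: seed n d}| => N; nia.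
Qed.

Hypothesis v0_neq0 : v i0 != 0.

Lemma convex_instance_convex u : grid_convex (convex_instance u).
Proof.
apply: (convex_base_perturbation v0_neq0 (g := fun B => (u B : nat)%:R / 60)) => B.
rewrite divr_ge0 ?ler0n //= ler_pdivrMr ?ltr0n // mul1r ler_nat.
by apply: ltnW; exact: ltn_ord (u B).
Qed.

Lemma far_instance_violation u (h : grid n d -> R) y :
  grid_convex h -> y \in centers -> u (block y) != -1 ->
  exists2 z, block z = block y & far_instance u z != h z.
Proof.
move=> convh yC unwrapped; pose a := translate v 1 y; pose b := translate v (-1) y.
have [blocka blockb] : block a = block y /\ block b = block y.
  by split; apply: block_translate => //; rewrite ?normrN1 ?normr1.
have [eqa|ne] := eqVneq (far_instance u a) (h a); last by exists a.
have [eqb|ne] := eqVneq (far_instance u b) (h b); last by exists b.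
have [eqy|ne] := eqVneq (far_instance u y) (h y); last by exists y.
have := convex_midpoint convh (translate_midpoint yC).
rewrite -/a -/b -eqa -eqb -eqy /far_instance /perturbed_base blocka blockb.
have [/andP[-> _]] : central i0 v y && interior v y by move: yC; rewrite inE.
rewrite !central_translate ?normrN1 ?normr1 // addr0 val_Zp_succ //.
rewrite !base_translate ?normrN1 ?normr1 //.
by rewrite !rmorphD /= -natr1; lra.
Qed.

Variable i1 : 'I_d.
Hypothesis v_coprime : coprimez (v i0) (v i1).

Lemma card_centers_le_dist u (h : grid n d -> R) : grid_convex h ->
  (#|centers| <= #|wrapped_centers u|
               + #|[set x | far_instance u x != h x]%SET|)%N.
Proof.
move=> convh; set W := wrapped_centers u; set diff := finset _.
rewrite -(cardsID W); apply: leq_add; first exact/subset_leq_card/finset.subsetIr.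
have inj : {in centers :\: W &, injective block}.
  move=> x y /setDP[xC _] /setDP[yC _].
  exact: (centers_block_inj v0_neq0 v_coprime).
rewrite -(card_in_imset inj); apply: leq_trans (leq_imset_card block diff).
apply/subset_leq_card/fintype.subsetP => _ /imsetP[y /setDP[yC yW] ->].
have unwrapped : u (block y) != -1 by move: yW; rewrite inE yC.
have [z <- zh] := far_instance_violation convh yC unwrapped.
by apply: imset_f; rewrite inE.
Qed.

Lemma far_instance_far u (eps : R) : eps <= 1 / 10 -> (0 < n)%N ->
  (3 * \sum_i `|v i| <= n)%N -> u \notin bad_seeds -> eps_far eps (far_instance u).
Proof.
move=> eps_le n_gt0 v_small + h convh; rewrite inE -leqNgt => few_wrapped.
have -> : #|[set: grid n d]%classic| = (n ^ d)%N.
  transitivity #|{: grid n d}|; last by rewrite card_ffun !card_ord.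
  by apply: eq_card => x; rewrite in_setT.
set dist := #|_|; have distE : dist = #|[set x | far_instance u x != h x]%SET|.
  by apply: eq_card => x; rewrite [RHS]inE; apply/idP/idP; rewrite in_setE.
have : (n ^ d <= 10 * dist)%N.
  have := card_centers_le_dist u convh.
  by have := card_centers v0_neq0 n_gt0 v_small; lia.
rewrite -(ler_nat R) natrM => le_dist.
have : eps * (n ^ d)%:R <= 1 / 10 * (n ^ d)%:R by rewrite ler_wpM2r.
by lra.
Qed.

End Instances.

(** * Counting directions *)

Lemma leq_sum_inverse_squares (a k : nat) (b : nat -> nat) : (2 <= k)%N ->
  (forall m, 2 <= m -> b m * m ^ 2 <= a)%N ->
  (4 * \sum_(2 <= m < k.+1) b m <= 3 * a)%N.
Proof.
move=> k_ge2 b_le.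
(* Strengthened with the telescoping tail [1 / k] of the sum of the [1 / m ^ 2]. *)
suff: (4 * k * (\sum_(2 <= m < k.+1) b m) + 4 * a <= 3 * k * a)%N.
  by move: (\sum_(_ <= _ < _) _)%N => S; nia.
elim: k k_ge2 => // k IHk; rewrite leq_eqVlt => /orP[/eqP <-|k_ge2].
  by rewrite big_nat1; have := b_le 2%N isT; lia.
rewrite big_nat_recr /=; last by lia.
move: (IHk k_ge2) (b_le k.+1 (ltnW k_ge2)).
move: (\sum_(_ <= _ < _) _)%N (b k.+1) => S c IH le_a.
rewrite -(@leq_pmul2l k); last by lia.
have : (k * k.+1 * c <= a)%N by nia.
by have := leq_mul (leqnn k.+1) IH; lia.
Qed.

Definition zigzag (k : nat) : int := (-1) ^+ k * (uphalf k)%:Z.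

Lemma absz_zigzag k : `|zigzag k|%N = uphalf k.
Proof. by rewrite /zigzag abszMsign. Qed.

Lemma zigzag_inj : injective zigzag.
Proof.
move=> k l eqz; have := congr1 absz eqz; move: eqz; rewrite !absz_zigzag.
rewrite /zigzag -[_ ^+ k]signr_odd -[_ ^+ l]signr_odd.
by case: (boolP (odd k)); case: (boolP (odd l)); rewrite ?expr0 ?expr1; lia.
Qed.

Lemma uphalf_sub_double (a r : nat) : uphalf (a - r.*2) = (uphalf a - r)%N.
Proof. by lia. Qed.

Lemma sub_double_inj (m a b r s : nat) :
  (m %| uphalf a)%N -> (m %| uphalf b)%N -> (0 < a)%N -> (0 < b)%N ->
  (r < m)%N -> (s < m)%N -> (a - r.*2 = b - s.*2)%N -> a = b /\ r = s.
Proof.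
move=> ma mb a_gt0 b_gt0 rm sm eq_sub.
have le_a : (m <= uphalf a)%N by apply: dvdn_leq => //; lia.
have le_b : (m <= uphalf b)%N by apply: dvdn_leq => //; lia.
have eqrs : r = s.
  rewrite -(modn_small rm) -(modn_small sm); apply/eqP.
  rewrite -(eqn_modDl (uphalf a - r)) subnK; last by lia.
  have -> : (uphalf a - r + s = uphalf b)%N by lia.
  by rewrite (eqP ma) (eqP mb).
by split; lia.
Qed.

Lemma double_sum_uphalf_le (d j : nat) (f : 'I_d -> nat) : (j <= d)%N ->
  (forall i : 'I_d, j <= i -> f i = 0)%N ->
  (2 * \sum_i uphalf (f i) <= \sum_i f i + j)%N.
Proof.
move=> le_jd f0; have -> : j = (\sum_(i < d) (i < j))%N.
  by rewrite -big_mkcond -(big_ord_widen d (fun=> 1%N)) // sum1_card card_ord.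
rewrite big_distrr -big_split; apply: leq_sum => i _ /=.
by have [_ | /f0 ->] := ltnP i j; first lia.
Qed.

Lemma sum_nth_ord (s : seq nat) (d : nat) : (size s <= d)%N ->
  (\sum_(i < d) nth 0 s i = \sum_(k <- s) k)%N.
Proof.
move=> le_sd; rewrite [RHS](big_nth 0%N) big_mkord.
rewrite [RHS](big_ord_widen d (nth 0%N s)) // [RHS]big_mkcond.
by apply: eq_bigr => i _; case: ltnP => // le_si; rewrite nth_default.
Qed.

Section Directions.
Variables (n d : nat).

(* The zigzag code turns moving an entry towards 0 into subtraction, whatever its
   sign, and a bound on the entries makes directions a finite type. *)
Definition direction : finType := {ffun 'I_d -> 'I_n.+1}.
Implicit Types (w : direction) (A : {set 'I_d}).

Definition vec w (i : 'I_d) : int := zigzag (w i).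

Lemma vec_inj w w' : vec w =1 vec w' -> w = w'.
Proof. by move=> eqv; apply/ffunP => i; apply/ord_inj/zigzag_inj/eqv. Qed.

Definition short_dirs A : {set direction} :=
  [set w : direction | [forall i in A, w i != ord0]
                       && (3 * (\sum_i uphalf (w i)) <= n)%N]%SET.

Lemma card_short_dirs_ge A (s j : nat) : (#|A| <= 2)%N ->
  (j <= d)%N -> (j <= s.*2)%N -> (3 * s.+1 <= n)%N ->
  (forall i, i \in A -> i < j)%N ->
  ('C(s.*2, j) <= #|short_dirs A|)%N.
Proof.
move=> card_A le_jd le_js s_small ltA; pose T := (s.*2 - j)%N.
have -> : 'C(s.*2, j) = 'C(j + T, j) by rewrite subnKC.
rewrite -card_partial_ord_partitions; set tup := finset _.
pose entry (t : j.-tuple 'I_T.+1) i := nth 0%N (map val t) i.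
have size_entry (t : j.-tuple 'I_T.+1) : size (map val t) = j.
  by rewrite size_map size_tuple.
have entry_le t i : (entry t i <= T)%N.
  have [lt_ij | le_ji] := ltnP i j.
    by rewrite /entry (nth_map ord0) ?size_tuple // -ltnS ltn_ord.
  by rewrite /entry nth_default // size_entry.
pose code t : direction := [ffun i : 'I_d => inord (entry t i + (i \in A))].
have codeE t i : code t i = (entry t i + (i \in A))%N :> nat.
  by rewrite ffunE inordK //; have := entry_le t i; lia.
have inj : {in tup &, injective code}.
  move=> t t' _ _ /ffunP eq_code; apply/val_inj/(inj_map val_inj).
  apply: (@eq_from_nth _ 0%N) => [|i]; rewrite !size_entry // => lt_ij.
  have /(congr1 val) := eq_code (Ordinal (leq_trans lt_ij le_jd)).
  by rewrite /= !codeE => /addIn.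
rewrite -(card_in_imset inj); apply/subset_leq_card/fintype.subsetP.
move=> _ /imsetP[t + ->]; rewrite !inE => sum_t; apply/andP; split.
  by apply/forall_inP => i iA; rewrite -val_eqE /= codeE iA addn1.
have code0 (i : 'I_d) : (j <= i)%N -> code t i = 0%N :> nat.
  move=> le_ji; rewrite codeE /entry nth_default ?size_entry //.
  by have /negPf -> : i \notin A by apply/negP => /ltA; rewrite ltnNge le_ji.
have : (2 * \sum_i uphalf (code t i) <= \sum_(k <- t) k + #|A| + j)%N.
  apply: leq_trans (double_sum_uphalf_le le_jd code0) _; rewrite leq_add2r.
  rewrite (eq_bigr _ (fun i _ => codeE t i)) big_split sum_nth_ord ?size_entry //=.
  by rewrite big_map -big_mkcond sum1_card.
by move: (\sum_i _)%N (\sum_(k <- t) _)%N sum_t; lia.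
Qed.

Definition divisible_dirs A (m : nat) : {set direction} :=
  [set w : direction | (w \in short_dirs A)
                       && [forall i in A, m %| uphalf (w i)]%N]%SET.

(* Moving every entry in [A] of a direction divisible by [m] towards 0, each by less
   than [m], is injective: the original entries are recovered by rounding up to
   multiples of [m]. *)
Lemma card_divisible_dirs A (m : nat) : (0 < m)%N ->
  (#|divisible_dirs A m| * m ^ #|A| <= #|short_dirs A|)%N.
Proof.
case: m => // m _; pose steps := pffun_on (ord0 : 'I_m.+1) A predT.
have -> : (m.+1 ^ #|A|)%N = #|steps| by rewrite card_pffun_on card_ord.
rewrite -cardX; set D := predX _ _.
pose shrink (z : direction * {ffun 'I_d -> 'I_m.+1}) : direction :=
  [ffun i => inord (z.1 i - (z.2 i).*2)].
have shrinkE w r i : shrink (w, r) i = (w i - (r i).*2)%N :> nat.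
  by rewrite ffunE inordK // ltnS (leq_trans (leq_subr _ _)) // -ltnS ltn_ord.
have divP w i : w \in divisible_dirs A m.+1 -> i \in A ->
    (0 < w i)%N /\ (m.+1 %| uphalf (w i))%N.
  rewrite !inE => /andP[/andP[/forall_inP nz _] /forall_inP dvd] iA.
  by rewrite lt0n (dvd i iA); have := nz i iA; rewrite -val_eqE.
have inj : {in D &, injective shrink}.
  move=> [w r] [w' r'] /andP[/= wD /pffun_onP[rA _]] /andP[/= wD' /pffun_onP[rA' _]].
  move/ffunP=> eq_shrink; have eqE i : w i = w' i :> nat /\ r i = r' i :> nat.
    have := congr1 val (eq_shrink i); rewrite /= !shrinkE /=.
    have [iA | iA] := boolP (i \in A).
      have [w0 wm] := divP w i wD iA; have [w0' wm'] := divP w' i wD' iA.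
      exact: (sub_double_inj wm wm' w0 w0' (ltn_ord _) (ltn_ord _)).
    have -> : r i = ord0 by apply: contraNeq iA => /(fintype.subsetP rA).
    have -> : r' i = ord0 by apply: contraNeq iA => /(fintype.subsetP rA').
    by rewrite !subn0.
  by congr (_, _); apply/ffunP => i; apply: ord_inj; case: (eqE i).
rewrite -(card_in_imset inj); apply/subset_leq_card/fintype.subsetP.
move=> _ /imsetP[[w r] /andP[/= wD _] ->]; rewrite inE; apply/andP; split.
  apply/forall_inP => i iA; rewrite -val_eqE /= shrinkE /= -lt0n.
  have [w0 wm] := divP w i wD iA; rewrite -uphalf_gt0 uphalf_sub_double subn_gt0.
  by rewrite (leq_trans (ltn_ord _)) // dvdn_leq // uphalf_gt0.
move: wD; rewrite !inE => /andP[/andP[_ small] _]; apply: leq_trans small.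
rewrite leq_mul2l; apply: leq_sum => i _.
by rewrite shrinkE uphalf_sub_double leq_subr.
Qed.

Variables i0 i1 : 'I_d.

Definition coprime_dirs : {set direction} :=
  [set w : direction | (w \in short_dirs [set i0; i1])
                       && coprimez (vec w i0) (vec w i1)]%SET.

Lemma coprime_dirsP w : w \in coprime_dirs ->
  [/\ vec w i0 != 0, (3 * (\sum_i `|vec w i|) <= n)%N
    & coprimez (vec w i0) (vec w i1)].
Proof.
rewrite !inE => /andP[/andP[/forall_inP nz small] cop]; split=> //.
  have := nz i0; rewrite !inE eqxx => /(_ isT).
  by rewrite -absz_eq0 absz_zigzag -val_eqE /=; lia.
by rewrite (eq_bigr (fun i => uphalf (w i))) // => i _; exact: absz_zigzag.
Qed.

Hypothesis i01 : i0 != i1.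

Lemma card_coprime_dirs :
  (#|short_dirs [set i0; i1]%SET| <= 4 * #|coprime_dirs|)%N.
Proof.
set A := [set i0; i1]%SET; set S := short_dirs A.
have i0A : i0 \in A by rewrite !inE eqxx.
have entry_le w : w \in S -> (0 < uphalf (w i0) /\ 3 * uphalf (w i0) <= n)%N.
  rewrite inE => /andP[/forall_inP/(_ i0 i0A) nz]; rewrite (bigD1 i0) //=.
  by move: nz (\sum_(_ | _) _)%N; rewrite -val_eqE /=; lia.
have [n_small | n_ge2] := ltnP n 2.
  rewrite (_ : #|S| = 0)%N // eq_card0 // => w.
  by apply/negP => /entry_le; lia.
have cover : S :\: coprime_dirs \subset
    \bigcup_(2 <= m < n.+1) divisible_dirs A m.
  apply/fintype.subsetP => w /setDP[wS]; rewrite inE wS /= => ncop.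
  have [w0 w_le] := entry_le w wS.
  pose g := gcdn (uphalf (w i0)) (uphalf (w i1)).
  have g_gt0 : (0 < g)%N by rewrite gcdn_gt0 w0.
  have g_le : (g <= uphalf (w i0))%N by rewrite dvdn_leq ?dvdn_gcdl.
  have g_ge2 : (2 <= g)%N.
    by move: ncop; rewrite coprimezE /coprime !absz_zigzag -/g; lia.
  rewrite (bigD1_seq g) ?iota_uniq ?mem_index_iota //=; last by lia.
  rewrite finset.in_setU inE wS /=; apply/orP; left; apply/forall_inP => i.
  by rewrite !inE => /orP[]/eqP->; rewrite ?dvdn_gcdl ?dvdn_gcdr.
have := leq_trans (subset_leq_card cover) (card_big_setU _ _ _).
have card_A : #|A| = 2%N by rewrite cards2 i01.
have dvd_le m : (2 <= m -> #|divisible_dirs A m| * m ^ 2 <= #|S|)%N.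
  by move=> m_ge2; rewrite -card_A card_divisible_dirs // ltnW.
have := leq_sum_inverse_squares n_ge2 dvd_le.
have := cardsID coprime_dirs S.
have : (#|S :&: coprime_dirs| <= #|coprime_dirs|)%N.
  exact/subset_leq_card/subsetIr.
by lia.
Qed.

End Directions.

(** * Binomial lower bounds *)

Lemma mul_central_binS s :
  (s.+1 * 'C(s.+1.*2, s.+1) = 2 * s.*2.+1 * 'C(s.*2, s))%N.
Proof.
have symm : 'C(s.*2.+1, s) = 'C(s.*2.+1, s.+1).
  by rewrite -bin_sub; [congr 'C(_, _); lia | lia].
rewrite doubleS binS symm addnn -mul2n mulnCA -mulnA.
by rewrite -(mul_bin_diag s.*2.+1 s).
Qed.

Lemma central_bin_ge_exp3 s : (0 < s)%N -> (2 * 3 ^ s <= 3 * 'C(s.*2, s))%N.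
Proof.
case: s => // s _; elim: s => // s IHs.
rewrite -(@leq_pmul2l s.+2) // [leqRHS]mulnCA mul_central_binS.
by move: IHs; rewrite (expnS 3 s.+1); move: (3 ^ s.+1)%N 'C(s.+1.*2, s.+1); nia.
Qed.

Lemma bin_mul_expn_le m k d : (k <= m)%N -> ('C(k, d) * m ^ d <= 'C(m, d) * k ^ d)%N.
Proof.
move=> le_km; rewrite -(leq_pmul2r (fact_gt0 d)).
rewrite mulnAC bin_ffact [leqRHS]mulnAC bin_ffact !ffact_prod.
have powE l : (l ^ d = \prod_(i < d) l)%N by rewrite prod_nat_const card_ord.
rewrite !powE -!big_split /=; apply: leq_prod => i _.
by rewrite !mulnBl [(m * k)%N]mulnC leq_sub2l // leq_mul2l le_km orbT.
Qed.

Section RealBounds.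
Variable R : realType.
Implicit Types x y : R.

Lemma central_bin_ge_exp s : (4 <= s)%N ->
  2 / 5 * (18 / 5) ^+ s <= 'C(s.*2, s)%:R :> R.
Proof.
elim: s => // s IHs; rewrite leq_eqVlt => /orP[/eqP <-|s_ge4].
  by rewrite (_ : 'C(_, _) = 70%N) // !exprS expr0; lra.
rewrite -(@ler_pM2l _ s.+1%:R) ?ltr0n // -natrM mul_central_binS natrM exprS.
have := IHs s_ge4; set a := _ ^+ s; set b := 'C(_, _)%:R => IH.
have b_ge0 : 0 <= b by exact: ler0n.
have s_ge4R : 4 <= s%:R :> R by rewrite ler_nat.
have -> : (2 * s.*2.+1)%:R = 4 * s%:R + 2 :> R.
  have -> : (2 * s.*2.+1 = 4 * s + 2)%N by lia.
  by rewrite natrD natrM.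
by rewrite -(natr1 s); nra.
Qed.

Lemma expR1_ge : 5 / 2 <= expR 1 :> R.
Proof.
have -> : expR 1 = expR 6^-1 ^+ 6 :> R by rewrite -expRM_natl mulfV // pnatr_eq0.
have : (7 / 6) ^+ 6 <= expR 6^-1 ^+ 6 :> R.
  by apply: lerXn2r; rewrite ?nnegrE ?expR_ge0; have := expR_ge1Dx (6^-1 : R); lra.
by apply: le_trans; rewrite !exprS expr0; lra.
Qed.

(* The rate 2/5 exceeds 1/e, as needed here, while exp (3 * 2/5) <= 18/5 stays below the
   growth rate 4 of the central binomial coefficients. *)
Lemma le_expR_two_fifths x : x <= expR (2 / 5 * x).
Proof.
have := expR_ge1Dx (2 / 5 * x - 1); rewrite addrCA subrr addr0 => le_x.
rewrite -(subrK 1 (2 / 5 * x)) expRD; have := expR1_ge.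
by have := expR_gt0 (2 / 5 * x - 1); nra.
Qed.

Lemma expR_six_fifths_le : expR (6 / 5) <= 18 / 5 :> R.
Proof.
have -> : 6 / 5 = 12%:R * 10^-1 :> R by lra.
rewrite expRM_natl.
have le_e : expR 10^-1 <= 10 / 9 :> R.
  have := expR_ge1Dx (- 10^-1 : R).
  have : expR 10^-1 * expR (- 10^-1) = 1 :> R.
    by rewrite expRN mulfV // gt_eqF ?expR_gt0.
  by have := expR_gt0 (10^-1 : R); nra.
apply: (@le_trans _ _ ((10 / 9) ^+ 12)); last by rewrite !exprS expr0; lra.
by apply: lerXn2r; rewrite ?nnegrE ?expR_ge0 //; lra.
Qed.

Lemma exprD_le_expR x y d : 0 < x -> 0 <= y ->
  (x + y) ^+ d <= x ^+ d * expR (d%:R * (y / x)).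
Proof.
move=> x_gt0 y_ge0; rewrite expRM_natl -exprMn.
apply: lerXn2r; rewrite ?nnegrE ?mulr_ge0 ?addr_ge0 ?expR_ge0 ?(ltW x_gt0) //.
have -> : x + y = x * (1 + y / x) by field; rewrite gt_eqF.
by rewrite ler_pM2l // expR_ge1Dx.
Qed.

Lemma bin_ge_small_dim (d s : nat) : (0 < d)%N -> (d <= s)%N ->
  2 / 3 * (3 * s%:R / d%:R) ^+ d <= 'C(s.*2, d)%:R :> R.
Proof.
move=> d_gt0 le_ds; have d_neq0 : d%:R != 0 :> R by rewrite pnatr_eq0 -lt0n.
have pow_gt0 : 0 < (d.*2 ^ d)%:R :> R by rewrite ltr0n expn_gt0; lia.
have : ('C(d.*2, d) * s.*2 ^ d)%:R <= ('C(s.*2, d) * d.*2 ^ d)%:R :> R.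
  by rewrite ler_nat bin_mul_expn_le // leq_double.
rewrite [in X in _ <= X]natrM -ler_pdivrMr //; apply: le_trans.
have -> : (3 * s%:R / d%:R) ^+ d = (3 ^ d)%:R * ((s.*2 ^ d)%:R / (d.*2 ^ d)%:R) :> R.
  rewrite !natrX -expr_div_n -exprMn; congr (_ ^+ _).
  by rewrite -!muln2 !natrM; field.
rewrite natrM mulrA -[leRHS]mulrA ler_wpM2r ?divr_ge0 //.
have : (2 * 3 ^ d)%:R <= (3 * 'C(d.*2, d))%:R :> R.
  by rewrite ler_nat central_bin_ge_exp3.
by rewrite !natrM; lra.
Qed.

Lemma exp_div_le (n d s : nat) : (0 < d)%N -> (n <= 3 * s + 5)%N ->
  (n%:R / d%:R) ^+ d <= expR 2 * (18 / 5) ^+ s :> R.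
Proof.
move=> d_gt0; rewrite -(ler_nat R) natrD natrM => n_le.
apply: (@le_trans _ _ (expR (2 / 5 * n%:R))).
  have -> : 2 / 5 * n%:R = d%:R * (2 / 5 * (n%:R / d%:R)) :> R.
    by field; rewrite pnatr_eq0 -lt0n.
  by rewrite expRM_natl lerXn2r ?nnegrE ?expR_ge0 ?divr_ge0 ?le_expR_two_fifths.
apply: (@le_trans _ _ (expR (2 + s%:R * (6 / 5)))); first by rewrite ler_expR; lra.
rewrite expRD expRM_natl ler_pM2l ?expR_gt0 //.
by rewrite lerXn2r ?nnegrE ?expR_ge0 ?expR_six_fifths_le.
Qed.

Lemma exp_div_le_small_dim (n d s : nat) : (0 < d)%N -> (d <= s)%N ->
  (n <= 3 * s + 5)%N -> (n%:R / d%:R) ^+ d <= expR 2 * (3 * s%:R / d%:R) ^+ d :> R.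
Proof.
move=> d_gt0 le_ds; rewrite -(ler_nat R) natrD natrM => n_le.
have d_gt0R : 0 < d%:R :> R by rewrite ltr0n.
have s_gt0R : 0 < s%:R :> R by rewrite ltr0n (leq_trans d_gt0).
apply: (@le_trans _ _ ((3 * s%:R / d%:R + 5 / d%:R) ^+ d)).
  rewrite lerXn2r ?nnegrE ?addr_ge0 ?divr_ge0 ?mulr_ge0 // -mulrDl.
  by rewrite ler_pM2r ?invr_gt0.
apply: le_trans (exprD_le_expR _ _ _) _; rewrite ?divr_gt0 ?divr_ge0 ?mulr_gt0 //.
rewrite mulrC ler_pM2r ?exprn_gt0 ?divr_gt0 ?mulr_gt0 // ler_expR.
have -> : d%:R * (5 / d%:R / (3 * s%:R / d%:R)) = 5 / 3 * (d%:R / s%:R) :> R.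
  by field; rewrite !gt_eqF.
have : d%:R / s%:R <= 1 :> R by rewrite ler_pdivrMr // mul1r ler_nat.
by lra.
Qed.

Lemma bin_minn_ge (n d s : nat) :
  (0 < d)%N -> (4 <= s)%N -> (n <= 3 * s + 5)%N ->
  2 / 5 * expR (- 2) * (n%:R / d%:R) ^+ d <= 'C(s.*2, minn s d)%:R :> R.
Proof.
move=> d_gt0 s_ge4 n_le.
suff: 2 / 5 * (n%:R / d%:R) ^+ d <= expR 2 * 'C(s.*2, minn s d)%:R :> R.
  by rewrite -ler_pdivrMl ?expR_gt0 // -expRN mulrA [expR _ * _]mulrC.
have e_gt0 := expR_gt0 (2 : R).
have [lt_sd | le_ds] := ltnP s d.
  have := exp_div_le d_gt0 n_le; have := central_bin_ge_exp s_ge4.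
  by nra.
have := exp_div_le_small_dim d_gt0 le_ds n_le; have := bin_ge_small_dim d_gt0 le_ds.
have : 0 <= (3 * s%:R / d%:R) ^+ d :> R by rewrite exprn_ge0 ?divr_ge0 ?mulr_ge0.
by nra.
Qed.

End RealBounds.

(** * From testers to counting *)

Section Averaging.
Variables (R : realType) (dm : measure_display) (Omega : measurableType dm).
Variable P : probability Omega R.
Local Open Scope ereal_scope.
Local Open Scope classical_set_scope.

Lemma sum_probability_le (I : finType) (A : {set I}) (E F : I -> set Omega)
    (M : nat) :
  (forall i, measurable (E i)) -> (forall i, measurable (F i)) ->
  (forall w, (\sum_(i in A) (w \in E i) <= \sum_(i in A) (w \in F i) + M)%N) ->
  \sum_(i in A) P (E i) <= \sum_(i in A) P (F i) + M%:R%:E.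
Proof.
move=> mE mF le_count.
have m_indic (C : I -> set Omega) i : (forall i, measurable (C i)) ->
    measurable_fun setT (fun w => (\1_(C i) w)%:E : \bar R).
  by move=> mC; apply/measurable_EFinP; exact: measurable_indic.
have sumE (C : I -> set Omega) : (forall i, measurable (C i)) ->
    \sum_(i in A) P (C i) = \int[P]_w \sum_(i <- enum A) (\1_(C i) w)%:E.
  move=> mC; rewrite ge0_integral_sum // => [|i]; last exact: m_indic.
  by rewrite -big_enum; apply: eq_bigr => i _; rewrite integral_indic // setIT.
have m_sum (C : I -> set Omega) : (forall i, measurable (C i)) ->
    measurable_fun setT (fun w => \sum_(i <- enum A) (\1_(C i) w)%:E : \bar R).
  by move=> mC; apply: emeasurable_sum => i; exact: m_indic.
have sum_ge0 (C : I -> set Omega) w :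
    0 <= \sum_(i <- enum A) (\1_(C i) w)%:E :> \bar R.
  by apply: sume_ge0 => i _; rewrite lee_fin.
have -> : M%:R%:E = \int[P]_w (M%:R%:E : \bar R).
  by rewrite integral_cst // -[LHS]mule1; congr (_ * _); exact/esym/probability_setT.
rewrite !sumE // -ge0_integralD //; last exact: m_sum.
apply: ge0_le_integral => //; first exact: m_sum.
  by apply: emeasurable_funD; [exact: m_sum | exact: measurable_cst].
move=> w _; rewrite !sumEFin -EFinD lee_fin.
have indicE (C : I -> set Omega) :
    (\sum_(i <- enum A) \1_(C i) w = (\sum_(i in A) (w \in C i))%:R :> R)%R.
  by rewrite natr_sum -big_enum; apply: eq_bigr => i _; rewrite indicE.
by rewrite !indicE -natrD ler_nat.
Qed.

End Averaging.

(* Yao's principle: it suffices to compare the two families on deterministic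
   query sets and decisions. *)
Lemma tester_family_bound (R : realType) (n d : nat) (eps : R)
    (dm : measure_display) (Omega : measurableType dm) (P : probability Omega R)
    (q : nat) (Q : Omega -> 'I_q -> grid n d) (D : Omega -> ('I_q -> R) -> bool)
    (I : finType) (A B : {set I}) (F G : I -> grid n d -> R) (M : nat) :
  nonadaptive_convexity_tester eps P Q D ->
  (forall i, i \in A -> grid_convex (F i)) ->
  (forall i, i \in A :\: B -> eps_far eps (G i)) ->
  (forall (S : 'I_q -> grid n d) (D0 : ('I_q -> R) -> bool),
    \sum_(i in A) D0 (fun k => F i (S k))
    <= \sum_(i in A) D0 (fun k => G i (S k)) + M)%N ->
  (#|A| <= 3 * (#|A :&: B| + M))%N.
Proof.
move=> [mD [acc_conv rej_far]] convF farG leFG.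
pose accept f := [set w | D w (fun k => f (Q w k))]%classic.
have le_sum : (\sum_(i in A) P (accept (F i))
               <= \sum_(i in A) P (accept (G i)) + M%:R%:E)%E.
  apply: sum_probability_le => [i|i|w]; [exact: mD | exact: mD |].
  have mem_accept f : (w \in accept f) = D w (fun k => f (Q w k)).
    by apply/idP/idP; rewrite in_setE.
  under eq_bigr do rewrite mem_accept; under [in leqRHS]eq_bigr do rewrite mem_accept.
  exact: leFG.
have le_accG i : i \in A -> (P (accept (G i)) <= (1 / 3 + (i \in B)%:R)%:E)%E.
  move=> iA; have [_ | iNB] := boolP (i \in B).
    by apply: le_trans (probability_le1 P (mD _)) _; rewrite lee_fin /=; lra.
  have /rej_far : eps_far eps (G i) by apply: farG; rewrite finset.in_setD iNB.
  have -> : ([set w | ~~ D w (fun k => G i (Q w k))] = ~` accept (G i))%classic.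
    by apply/seteqP; split=> w /= /negP.
  rewrite probability_setC; last exact: mD.
  have : P (accept (G i)) \is a fin_num by apply: fin_num_measure; exact: mD.
  by case: (P _) => // p _; rewrite -EFinB !lee_fin addr0; lra.
have lower : ((\sum_(i in A) (2 / 3 : R))%:E <= \sum_(i in A) P (accept (F i)))%E.
  by rewrite -sumEFin; apply: lee_sum => i /convF/acc_conv.
have upper : (\sum_(i in A) P (accept (G i))
              <= (\sum_(i in A) (1 / 3 + (i \in B)%:R : R))%:E)%E.
  by rewrite -sumEFin; apply: lee_sum.
have := le_trans lower (le_trans le_sum (leeD2r _ upper)).
rewrite -EFinD lee_fin big_split /= !sumr_const -natr_sum -big_mkcondr sum1_card.
have -> : #|[pred i in A | i \in B]| = #|A :&: B|.
  by apply: eq_card => i; rewrite !inE.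
rewrite -[2 / 3 *+ _]mulr_natr -[1 / 3 *+ _]mulr_natr.
by rewrite -(ler_nat R) natrM natrD; lra.
Qed.

Section Collisions.
Variables (n d : nat) (i0 i1 : 'I_d).
Implicit Types a b : grid n d.

Definition colliding_dirs a b : {set direction n d} :=
  [set w | (w \in coprime_dirs n i0 i1)
    && (block i0 (vec w) a == block i0 (vec w) b)]%SET.

Lemma card_colliding_dirs a b : a != b -> (#|colliding_dirs a b| <= 4)%N.
Proof.
move=> ne_ab; pose multiples (t : int) : {set direction n d} :=
  [set w | [forall i, (b i : nat)%:Z == (a i : nat)%:Z + t * vec w i]]%SET.
have card_multiples t : t != 0 -> (#|multiples t| <= 1)%N.
  move=> t0; apply/card_le1_eqP => w w'; rewrite !inE => /forallP bE /forallP bE'.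
  apply: vec_inj => i; apply: (mulfI t0); apply: (@addrI _ (a i : nat)%:Z).
  by rewrite -(eqP (bE i)) -(eqP (bE' i)).
pose ts : seq int := [:: 1; -1; 2; -2].
have cover : colliding_dirs a b \subset \bigcup_(t <- ts) multiples t.
  apply/fintype.subsetP => w; rewrite inE => /andP[/coprime_dirsP[v0 _ cop] /eqP eqB].
  have [t t_le bE] := eq_block_multiple v0 cop eqB.
  have t_neq0 : t != 0.
    apply: contraNneq ne_ab => t0; apply/eqP/ffunP => i; apply: ord_inj.
    by have := bE i; rewrite t0 mul0r addr0 => -[].
  have t_ts : t \in ts by rewrite !inE; move: t_le t_neq0; clear; lia.
  rewrite (bigD1_seq t) //= finset.in_setU inE.
  by apply/orP; left; apply/forallP => i; rewrite bE.
apply: leq_trans (subset_leq_card cover) (leq_trans (card_big_setU _ _ _) _).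
apply: (@leq_trans (\sum_(t <- ts) 1)); last by rewrite sum1_size.
rewrite big_seq [leqRHS]big_seq; apply: leq_sum => t t_ts.
by apply: card_multiples; apply: contraTneq t_ts => ->.
Qed.

Definition collides (q : nat) (S : 'I_q -> grid n d) (v : 'I_d -> int) : bool :=
  [exists a, exists b, (S a != S b) && (block i0 v (S a) == block i0 v (S b))].

Lemma card_collides (q : nat) (S : 'I_q -> grid n d) :
  (#|[set w | (w \in coprime_dirs n i0 i1) && collides S (vec w)]%SET|
   <= 4 * q ^ 2)%N.
Proof.
set X := finset _.
have cover : X \subset \bigcup_(ab : 'I_q * 'I_q | S ab.1 != S ab.2)
                         colliding_dirs (S ab.1) (S ab.2).
  apply/fintype.subsetP => w; rewrite inE => /andP[wV].
  move=> /existsP[a /existsP[b /andP[ne eqB]]].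
  by apply/finset.bigcupP; exists (a, b) => //; rewrite inE wV.
apply: leq_trans (subset_leq_card cover) (leq_trans (card_big_setU _ _ _) _).
apply: (@leq_trans (\sum_(ab : 'I_q * 'I_q) 4)).
  rewrite big_mkcond; apply: leq_sum => ab _.
  by case: ifP => // ne; exact: card_colliding_dirs.
by rewrite sum_nat_const card_prod !card_ord mulnC -mulnn.
Qed.

End Collisions.

Section Views.
Variables (R : realType) (n d q : nat) (i0 : 'I_d) (S : 'I_q -> grid n d).

(* Adding 1 to the seed on the blocks whose central point is queried is a bijection of
   the seeds, under which the queried values of the far and convex instances agree. *)
Lemma eq_sum_views (v : 'I_d -> int) (D : ('I_q -> R) -> bool) : ~~ collides i0 S v ->
  (\sum_u D (fun a => convex_instance R i0 v u (S a))
   = \sum_u D (fun a => far_instance R i0 v u (S a)))%N.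
Proof.
move=> no_collision.
have S_inj a b : block i0 v (S a) = block i0 v (S b) -> S a = S b.
  move=> eqB; apply/eqP; apply: contraNT no_collision => ne.
  by apply/existsP; exists a; apply/existsP; exists b; rewrite ne eqB eqxx.
pose c : seed n d :=
  [ffun B => [exists a, (block i0 v (S a) == B) && central i0 v (S a)]%:R].
rewrite (reindex_inj (addIr c)); apply: eq_bigr => u _.
congr (nat_of_bool (D _)); apply/funext => a.
rewrite /convex_instance /far_instance /perturbed_base !ffunE.
congr (_ + (nat_of_ord (_ + _%:R))%:R / _); congr nat_of_bool.
apply/existsP/idP => [[b /andP[/eqP/S_inj -> //]] | ca].
by exists a; rewrite eqxx.
Qed.

Lemma sum_views_le (i1 : 'I_d) (D : ('I_q -> R) -> bool) :
  (\sum_(z in finset.setX (coprime_dirs n i0 i1) [set: seed n d]%SET)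
     D (fun a => convex_instance R i0 (vec z.1) z.2 (S a))
   <= \sum_(z in finset.setX (coprime_dirs n i0 i1) [set: seed n d]%SET)
        D (fun a => far_instance R i0 (vec z.1) z.2 (S a))
      + 4 * q ^ 2 * #|{: seed n d}|)%N.
Proof.
pose yes (w : direction n d) u : nat :=
  D (fun a => convex_instance R i0 (vec w) u (S a)).
pose no (w : direction n d) u : nat :=
  D (fun a => far_instance R i0 (vec w) u (S a)).
have sum_setX (f : direction n d -> seed n d -> nat) :
    (\sum_(z in finset.setX (coprime_dirs n i0 i1) [set: seed n d]%SET) f z.1 z.2
     = \sum_(w in coprime_dirs n i0 i1) \sum_u f w u)%N.
  by rewrite pair_big; apply: eq_bigl => z; rewrite !inE.
rewrite (sum_setX yes) (sum_setX no).
apply: (@leq_trans (\sum_(w in coprime_dirs n i0 i1) (\sum_u no w u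
    + (if collides i0 S (vec w) then #|{: seed n d}| else 0)))%N).
  apply: leq_sum => w _; case: ifPn => [_ | nc]; last first.
    by rewrite addn0 (eq_sum_views _ nc).
  apply: leq_trans (leq_addl _ _); rewrite -sum1_card.
  by apply: leq_sum => u _; exact: leq_b1.
rewrite big_split leq_add2l -big_mkcondr sum_nat_const leq_mul2r.
apply/orP; right; apply: leq_trans (card_collides i0 i1 S).
by apply: eq_leq; apply: eq_card => w; rewrite [RHS]inE.
Qed.

End Views.

Section QueryBound.
Variables (R : realType) (n d : nat) (eps : R).
Variables (dm : measure_display) (Omega : measurableType dm).
Variables (P : probability Omega R) (q : nat).
Variables (Q : Omega -> 'I_q -> grid n d) (D : Omega -> ('I_q -> R) -> bool).
Hypothesis eps_le : eps <= 1 / 10.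
Hypothesis tester : nonadaptive_convexity_tester eps P Q D.

Lemma card_coprime_dirs_le_queries (i0 i1 : 'I_d) : (0 < n)%N ->
  (#|coprime_dirs n i0 i1| <= 24 * q ^ 2)%N.
Proof.
move=> n_gt0; set V := coprime_dirs n i0 i1.
pose A := finset.setX V [set: seed n d]%SET.
pose B : {set direction n d * seed n d} :=
  [set z : direction n d * seed n d | z.2 \in bad_seeds n i0 (vec z.1)]%SET.
have convF z : z \in A -> grid_convex (convex_instance R i0 (vec z.1) z.2).
  by case: z => w u /setXP[/coprime_dirsP[v0 _ _] _]; exact: convex_instance_convex.
have farG z : z \in A :\: B -> eps_far eps (far_instance R i0 (vec z.1) z.2).
  case: z => w u /setDP[/setXP[/coprime_dirsP[v0 small cop] _]]; rewrite inE => good.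
  exact: (far_instance_far v0 cop).
have := tester_family_bound tester convF farG (fun S => sum_views_le i0 S i1).
have card_AB : (6 * #|A :&: B| <= #|V| * #|{: seed n d}|)%N.
  have AB_E z : (z \in A :&: B) = (z.1 \in V) && (z.2 \in bad_seeds n i0 (vec z.1)).
    case: z => w u; rewrite finset.in_setI finset.in_setX finset.in_setT andbT.
    by rewrite [_ \in B]inE.
  rewrite -sum1_card (eq_bigl _ _ AB_E).
  rewrite -(pair_big_dep (mem V) (fun w u => u \in bad_seeds n i0 (vec w))
                         (fun=> fun=> 1%N)).
  rewrite big_distrr -sum_nat_const; apply: leq_sum => w _ /=.
  by rewrite sum1_card; exact: card_bad_seeds.
have seed_gt0 : (0 < #|{: seed n d}|)%N by apply/card_gt0P; exists [ffun=> 0].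
rewrite cardsX cardsT => le_A; rewrite -(leq_pmul2r seed_gt0); move: le_A card_AB.
by move: #|V| #|A :&: B| #|{: seed n d}| => a b N; lia.
Qed.

Lemma bin_le_queries (s : nat) : (2 <= d)%N -> (2 <= s)%N -> (3 * s.+1 <= n)%N ->
  ('C(s.*2, minn s d) <= 96 * q ^ 2)%N.
Proof.
move=> d_ge2 s_ge2 s_small.
pose i0 : 'I_d := Ordinal (ltnW d_ge2); pose i1 : 'I_d := Ordinal d_ge2.
have n_gt0 : (0 < n)%N by lia.
apply: leq_trans (card_short_dirs_ge (A := [set i0; i1]%SET) _ _ _ s_small _) _.
- by rewrite cards2.
- by rewrite geq_minr.
- by rewrite (leq_trans (geq_minl _ _)) // -addnn leq_addr.
- by move=> i; rewrite !inE => /orP[]/eqP-> /=; lia.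
apply: leq_trans (card_coprime_dirs n (i0 := i0) (i1 := i1) isT) _.
by have := card_coprime_dirs_le_queries i0 i1 n_gt0; lia.
Qed.

End QueryBound.

Theorem theorem1p6 (R : realType) :
  exists c : R, 0 < c /\
  exists n0 : nat,
  forall (d n : nat) (eps : R),
    (2 <= d)%N -> (n0 <= n)%N -> eps <= 1 / 10 ->
  forall (dm : measure_display) (Omega : measurableType dm)
         (P : probability Omega R) (q : nat)
         (Q : Omega -> 'I_q -> grid n d) (D : Omega -> ('I_q -> R) -> bool),
    nonadaptive_convexity_tester eps P Q D ->
    c * ((n%:R / d%:R) `^ (d%:R / 2)) <= q%:R.
Proof.
pose K : R := 2 / 5 * expR (- 2) / 96.
have K_gt0 : 0 < K by rewrite divr_gt0 // mulr_gt0 ?expR_gt0 ?divr_gt0.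
exists (Num.sqrt K); split; first by rewrite sqrtr_gt0.
exists 15%N => d n eps d_ge2 n_ge15 eps_le dm Omega P q Q D tester.
pose s := (n %/ 3).-1.
have [s_ge4 s_small n_le] : [/\ 4 <= s, 3 * s.+1 <= n & n <= 3 * s + 5]%N.
  by rewrite /s; split; lia.
have le_queries := bin_le_queries eps_le tester d_ge2 (ltnW (ltnW s_ge4)) s_small.
have pow_ge0 : 0 <= n%:R / d%:R :> R by rewrite divr_ge0.
rewrite -ler_sqr ?nnegrE ?mulr_ge0 ?sqrtr_ge0 ?powR_ge0 //.
rewrite exprMn sqr_sqrtr ?(ltW K_gt0) // -powR_mulrn ?powR_ge0 // -powRrM.
rewrite divfK ?pnatr_eq0 // powR_mulrn //.
have := bin_minn_ge R (ltnW d_ge2) s_ge4 n_le.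
move: le_queries; rewrite -(ler_nat R) natrM natrX /K => le_queries le_bin.
by have := le_trans le_bin le_queries; lra.
Qed.
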